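(* Let $n\ge1$. (a) Any non-zero element $d\in(W_\infty^{(n)})_{-1}$ is non-degenerate. (b) Any parabolic subalgebra of $W_\infty^{(n)}$ is non-degenerate. (c) Let $d=t^{-1}b(D)=t^{-1}a(D)[D]_n\in(W_\infty^{(n)})_{-1}$, where $a\in\mathbb C[w]$ and $b(w)=a(w)[w]_n$. Then $$(W_\infty^{(n)})_0^d:=[(W_\infty^{(n)})_1,d]=\mathrm{span}\{[D-1]_n\,g(D)b(D)-[D]_n\,g(D+1)b(D+1)\ :\ g\in\mathbb C[w]\}.$$
   Context: $[x]_l=x(x-1)\cdots(x-l+1)$. Let $\mathcal D$ be the Lie algebra of differential operators on $\mathbb C[t,t^{-1}]$ with Laurent polynomial coefficients, spanned by $t^kf(D)$, $k\in\mathbb Z$, $f\in\mathbb C[w]$, $D=t\partial_t$. Let $\Psi$ be the skew-symmetric 2-cocycle with $\Psi(t^rf(D),t^sg(D))=\sum_{-r\le m\le-1}f(m)g(m+r)$ if $r=-s\ge0$ and $0$ if $r+s\ne0$. $W_\infty^{(n)}=\mathcal D\partial_t^n\oplus\mathbb C C$ with bracket $[t^rf(D),t^sg(D)]=t^{r+s}(f(D+s)g(D)-f(D)g(D+r))+\Psi(t^rf(D),t^sg(D))C$, $C$ central; it is $\mathbb Z$-graded with $(W_\infty^{(n)})_j=\{t^jf(D)[D]_n:f\in\mathbb C[w]\}+\delta_{j0}\mathbb C C$. For a $\mathbb Z$-graded Lie algebra $\mathfrak g=\oplus_j\mathfrak g_j$: a parabolic subalgebra is a graded subalgebra $\mathfrak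 p=\oplus_j\mathfrak p_j$ with $\mathfrak p_j=\mathfrak g_j$ for $j\ge0$ and $\mathfrak p_j\neq0$ for some $j<0$; it is non-degenerate if $\mathfrak p_{-j}$ has finite codimension in $\mathfrak g_{-j}$ for all $j>0$. For $0\ne a\in\mathfrak g_{-1}$, $\mathfrak p^a=\oplus_j\mathfrak p_j^a$ is the parabolic subalgebra with $\mathfrak p^a_j=\mathfrak g_j$ ($j\ge0$), $\mathfrak p^a_{-1}$ = span of all iterated brackets $[\dots[[a,\mathfrak g_0],\mathfrak g_0],\dots]$ including $a$ itself, $\mathfrak p^a_{-k-1}=[\mathfrak p^a_{-1},\mathfrak p^a_{-k}]$ ($k\ge1$); $a$ is non-degenerate if $\mathfrak p^a$ is non-degenerate. *)

(* Defs.v *)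
From HB Require Import structures.
From mathcomp Require Import all_boot all_order all_algebra finmap.
From mathcomp Require Import boolp classical_sets reals complex.
From mathcomp.multinomials Require Import monalg.
From mathcomp Require Import zify ring.

Set Implicit Arguments.
Unset Strict Implicit.
Unset Printing Implicit Defensive.

Import Order.TTheory GRing.Theory Num.Theory.
Local Open Scope classical_set_scope.
Local Open Scope ring_scope.

HB.mixin Record Lmodule_isLie (F : fieldType) L of GRing.Lmodule F L := {
  lieb : L -> L -> L;
  liebDl : forall x y z, lieb (x + y) z = lieb x z + lieb y z;
  liebDr : forall x y z, lieb x (y + z) = lieb x y + lieb x z;
  liebZl : forall a x y, lieb (a *: x) y = a *: lieb x y;
  liebZr : forall a x y, lieb x (a *: y) = a *: lieb x y;
  liebxx : forall x, lieb x x = 0;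
  lieb_jacobi : forall x y z,
    lieb x (lieb y z) + lieb y (lieb z x) + lieb z (lieb x y) = 0
}.

#[short(type="lieAlgType")]
HB.structure Definition LieAlgebra (F : fieldType) :=
  { L of GRing.Lmodule F L & Lmodule_isLie F L }.

Section Subspaces.
Variables (F : fieldType) (V : lmodType F).
Implicit Types A B : set V.

Definition subspace A : Prop :=
  A 0 /\ forall a u v, A u -> A v -> A (a *: u + v).

Definition lspan A : set V := smallest subspace A.

(* The quotient B / (A `&` B) is spanned by the classes of finitely many vectors
   of B. *)
Definition finite_codim A B : Prop :=
  exists s : seq V, (forall u, u \in s -> B u) /\
    forall v, B v -> exists c : nat -> F,
      A (v - \sum_(i < size s) c i *: s`_i).

Lemma subspaceD A u v : subspace A -> A u -> A v -> A (u + v).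
Proof. by move=> [_ sA] Au Av; rewrite -[u]scale1r; apply: sA. Qed.

Lemma subspaceZ A a u : subspace A -> A u -> A (a *: u).
Proof. by move=> [A0 sA] Au; rewrite -[_ *: _]addr0; apply: sA. Qed.

Lemma subspaceN A u : subspace A -> A u -> A (- u).
Proof. by move=> sA Au; rewrite -scaleN1r; apply: subspaceZ. Qed.

Lemma subspace_span A : subspace (lspan A).
Proof.
split=> [B [[B0 _] _] //|a u v Au Av B [sB AB]].
by apply: sB.2; [apply: Au|apply: Av].
Qed.

Lemma lspan_sub A B : subspace B -> A `<=` B -> lspan A `<=` B.
Proof. exact: smallest_sub. Qed.

Lemma sub_lspan A : A `<=` lspan A.
Proof. exact: sub_gen_smallest. Qed.

End Subspaces.

Section GradedLie.
Variables (F : fieldType) (L : lieAlgType F).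
Implicit Types (A B : set L) (g p : int -> set L) (a x y z : L).

Definition lieb_set A B : set L := lspan [set lieb x y | x in A & y in B].

(* A graded subspace is given by the family of its homogeneous components; the
   graded Lie algebra g itself is a graded subalgebra of an ambient L. *)
Record graded_lie_subalgebra g : Prop := {
  gr_subspace : forall j, subspace (g j);
  gr_lieb : forall i j x y, g i x -> g j y -> g (i + j) (lieb x y);
  gr_direct : forall (s : seq int) (x : int -> L), uniq s ->
    (forall j, g j (x j)) -> \sum_(j <- s) x j = 0 ->
    forall j, j \in s -> x j = 0
}.

Record parabolic g p : Prop := {
  pb_sub : forall j, p j `<=` g j;
  pb_subspace : forall j, subspace (p j);
  pb_lieb : forall i j x y, p i x -> p j y -> p (i + j) (lieb x y);
  pb_ge0 : forall j, 0 <= j -> p j = g j;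
  pb_neg : exists j x, [/\ j < 0, p j x & x != 0]
}.

Definition nondegenerate_parabolic g p : Prop :=
  forall j, 0 < j -> finite_codim (p (- j)) (g (- j)).

Inductive iter_lieb (g0 : set L) a : L -> Prop :=
| iter_lieb0 : iter_lieb g0 a a
| iter_liebS x y : iter_lieb g0 a x -> g0 y -> iter_lieb g0 a (lieb x y).

Definition parabolic_m1 g a : set L := lspan (iter_lieb (g 0) a).

(* Component of degree - (k + 1). *)
Fixpoint parabolic_neg g a (k : nat) : set L :=
  if k is k'.+1 then lieb_set (parabolic_m1 g a) (parabolic_neg g a k')
  else parabolic_m1 g a.

Definition parabolic_of g a (j : int) : set L :=
  match j with Posz _ => g j | Negz k => parabolic_neg g a k end.

Definition nondegenerate_elt g a : Prop :=
  nondegenerate_parabolic g (parabolic_of g a).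

Lemma lieb0l y : lieb 0 y = 0 :> L.
Proof. by rewrite -[X in lieb X _](scale0r 0) liebZl scale0r. Qed.

Lemma lieb0r x : lieb x 0 = 0 :> L.
Proof. by rewrite -[X in lieb _ X](scale0r 0) liebZr scale0r. Qed.

Lemma liebC x y : lieb x y = - lieb y x :> L.
Proof.
have := liebxx (x + y); rewrite liebDl !liebDr !liebxx add0r addr0.
by move/eqP; rewrite addr_eq0 => /eqP.
Qed.

Lemma liebNl x y : lieb (- x) y = - lieb x y :> L.
Proof. by rewrite -scaleN1r liebZl scaleN1r. Qed.

Lemma lieb_leibniz x y z :
  lieb (lieb x y) z = lieb (lieb x z) y + lieb x (lieb y z) :> L.
Proof.
move: (lieb_jacobi x y z) => /eqP; rewrite addr_eq0 => /eqP J.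
rewrite (liebC _ z) -J addrC; congr (_ + _).
by rewrite liebC (liebC z x) liebNl opprK.
Qed.

Lemma subspace_parabolic_neg g a k : subspace (parabolic_neg g a k).
Proof. by case: k => [|k]; apply: subspace_span. Qed.

Lemma subspace_lieb_l A y : subspace A -> subspace [set x | A (lieb x y)].
Proof.
move=> sA; split=> [|c u v /= Au Av]; first by rewrite /= lieb0l; case: sA.
by rewrite liebDl liebZl; apply: sA.2.
Qed.

Lemma sub_lieb_set A B x y : A x -> B y -> lieb_set A B (lieb x y).
Proof. by move=> Ax By; apply: sub_lspan; exists x => //; exists y. Qed.

Lemma lieb_set_sub A B D : subspace D ->
  (forall x y, A x -> B y -> D (lieb x y)) -> lieb_set A B `<=` D.
Proof. by move=> sD AB; apply: lspan_sub => // _ [x Ax [y By <-]]; apply: AB. Qed.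

Lemma parabolic_of_parabolic g a :
  graded_lie_subalgebra g -> g (- 1) a -> a != 0 ->
  parabolic g (parabolic_of g a).
Proof.
move=> gg ga a0; have sg := gr_subspace gg; have bg := gr_lieb gg.
have sn := @subspace_parabolic_neg g a.
pose P := parabolic_neg g a; pose Q := parabolic_of g a.
have neg_sub k : P k `<=` g (Negz k).
  elim: k => [|k IH].
    apply: lspan_sub => // x; elim=> [|{}x y _ gx gy]; first exact: ga.
    by rewrite -[Negz 0]addr0; apply: bg.
  rewrite (_ : Negz k.+1 = Negz 0 + Negz k); last by lia.
  apply: lieb_set_sub => // x y px py; apply: (bg); last exact: IH.
  move: x px {py}; apply: lspan_sub => // x.
  elim=> [|{}x z _ gx gz]; first exact: ga.
  by rewrite -[Negz 0]addr0; apply: bg.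
have Qsub j : Q j `<=` g j by case: j => [j|k] //=; apply: neg_sub.
have sQ j : subspace (Q j) by case: j => [j|k]; [exact: sg|exact: sn].
have Q0 k x y : P k x -> g 0 y -> P k (lieb x y).
  elim: k x y => [|k IH] x y px gy; move: x px.
    apply: (lspan_sub (B := [set x | P 0%N (lieb x y)])).
      exact: subspace_lieb_l (sn 0%N).
    by move=> x ix /=; apply: (@sub_lspan _ L); apply: iter_liebS.
  apply: (lieb_set_sub (D := [set x | P k.+1 (lieb x y)])).
    exact: subspace_lieb_l (sn k.+1).
  move=> u v pu pv /=; rewrite lieb_leibniz; apply: (subspaceD (sn k.+1)).
    apply: sub_lieb_set => //; move: u pu {pv}.
    apply: (lspan_sub (B := [set x | P 0%N (lieb x y)])).
      exact: subspace_lieb_l (sn 0%N).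
    by move=> x ix /=; apply: (@sub_lspan _ L); apply: iter_liebS.
  by apply: sub_lieb_set => //; apply: IH.
have Q1 m u z : P 0%N u -> Q m z -> Q (m - 1) (lieb u z).
  move=> pu; case: m => [[|m]|k] qz.
  - by rewrite sub0r; apply: (Q0 0%N).
  - rewrite (_ : Posz m.+1 - 1 = m); last by lia.
    rewrite /Q /= (_ : Posz m = Negz 0 + m.+1); last by lia.
    by apply: (bg) => //; apply: neg_sub.
  - rewrite (_ : Negz k - 1 = Negz k.+1); last by lia.
    exact: sub_lieb_set.
have Qpos k (j : nat) x y : P k x -> g j y -> Q (Negz k + j) (lieb x y).
  elim: k j x y => [|k IH] j x y px gy.
    by rewrite (_ : Negz 0 + j = j%:Z - 1); [apply: Q1|lia].
  case: j gy => [|j] gy; first by rewrite addr0; exact: (Q0 k.+1).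
  move: x px; apply: (lieb_set_sub
    (D := [set x | Q (Negz k.+1 + j.+1) (lieb x y)])).
    exact: subspace_lieb_l.
  move=> u v pu pv /=; rewrite lieb_leibniz; apply: subspaceD => //.
    rewrite liebC; apply: subspaceN => //.
    rewrite (_ : Negz k.+1 + j.+1 = Negz k + j); last by lia.
    apply: (IH) => //; have := @Q1 j.+1 u y pu gy.
    by rewrite (_ : j.+1%:Z - 1 = j) //; lia.
  rewrite (_ : Negz k.+1 + j.+1 = Negz k + j.+1 - 1); last by lia.
  by apply: Q1 => //; apply: IH.
have Qneg i j x y : P i x -> P j y -> P (i + j).+1 (lieb x y).
  elim: i j x y => [|i IH] j x y px py; first exact: sub_lieb_set.
  move: x px; apply: (lieb_set_sub
    (D := [set x | P (i.+1 + j).+1 (lieb x y)])).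
    exact: (subspace_lieb_l _ (sn _)).
  move=> u v pu pv /=; rewrite lieb_leibniz; apply: (subspaceD (sn _)).
    rewrite liebC; apply: (subspaceN (sn _)).
    rewrite addSnnS; apply: IH => //; exact: sub_lieb_set.
  by apply: sub_lieb_set => //; apply: IH.
split=> //.
- move=> [i|i] [j|j] x y qx qy.
  + exact: bg.
  + rewrite liebC addrC; apply: subspaceN => //; exact: Qpos.
  + exact: Qpos.
  + exact: Qneg.
- by case.
- by exists (- 1), a; split=> //; apply: sub_lspan; apply: iter_lieb0.
Qed.

End GradedLie.

Section BilinearExtension.
Variables (A B V : zmodType).

(* Biadditive extension of [b], given on monomials: [b r s f g] is the value at
   (<< f *g r >>, << g *g s >>). *)
Definition biext (b : int -> int -> A -> B -> V)
    (x : {malg A[int]}) (y : {malg B[int]}) : V :=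
  \sum_(r <- msupp x) \sum_(s <- msupp y) b r s x@_r y@_s.

Variable b : int -> int -> A -> B -> V.
Hypothesis bDl : forall r s f f' g, b r s (f + f') g = b r s f g + b r s f' g.
Hypothesis bDr : forall r s f g g', b r s f (g + g') = b r s f g + b r s f g'.

Let b0l r s g : b r s 0 g = 0.
Proof. by apply: (addrI (b r s 0 g)); rewrite -bDl !addr0. Qed.

Let b0r r s f : b r s f 0 = 0.
Proof. by apply: (addrI (b r s f 0)); rewrite -bDr !addr0. Qed.

Lemma biextEw (d e : {fset int}) x y : (msupp x `<=` d)%fset ->
  (msupp y `<=` e)%fset ->
  biext b x y = \sum_(r <- d) \sum_(s <- e) b r s x@_r y@_s.
Proof.
move=> xd ye; rewrite /biext (big_fset_incl _ xd) /=.
  apply: eq_bigr => r _; apply: big_fset_incl => // s _ /mcoeff_outdom ->.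
  exact: b0r.
by move=> r _ /mcoeff_outdom ->; rewrite big1.
Qed.

Lemma biextDl x x' y : biext b (x + x') y = biext b x y + biext b x' y.
Proof.
pose d := (msupp x `|` msupp x')%fset.
rewrite !(@biextEw d (msupp y)) ?fsubsetUl ?fsubsetUr ?fsubset_refl ?msuppD_le //.
rewrite -big_split; apply: eq_bigr => r _; rewrite -big_split.
by apply: eq_bigr => s _; rewrite mcoeffD bDl.
Qed.

Lemma biextDr x y y' : biext b x (y + y') = biext b x y + biext b x y'.
Proof.
pose d := (msupp y `|` msupp y')%fset.
rewrite !(@biextEw (msupp x) d) ?fsubsetUl ?fsubsetUr ?fsubset_refl ?msuppD_le //.
rewrite -big_split; apply: eq_bigr => r _; rewrite -big_split.
by apply: eq_bigr => s _; rewrite mcoeffD bDr.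
Qed.

Lemma biextU r s f g : biext b << f *g r >> << g *g s >> = b r s f g.
Proof.
rewrite (@biextEw [fset r]%fset [fset s]%fset) ?msuppU_le //.
by rewrite !big_seq_fset1 !mcoeffUU.
Qed.

Lemma biext0l y : biext b 0 y = 0.
Proof. by rewrite /biext msupp0 big_seq_fset0. Qed.

Lemma biext0r x : biext b x 0 = 0.
Proof. by rewrite /biext big1 // => r _; rewrite msupp0 big_seq_fset0. Qed.

End BilinearExtension.

Lemma malg_monomial_ind (A : zmodType) (P : {malg A[int]} -> Prop) :
  P 0 -> (forall x y, P x -> P y -> P (x + y)) ->
  (forall r f, P << f *g r >>) -> forall x, P x.
Proof. by move=> P0 PD PU x; rewrite [x]monalgE; apply: big_ind. Qed.

(* x : diffop F is the operator \sum_k t^k x@_k(D), where D = t d/dt. *)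
Definition diffop (F : fieldType) := {malg {poly F}[int]}.

(* The operations are those of {malg {poly F}[int]}, with scalars restricted to
   F; they are locked because unfolding them slows down unification. *)
HB.lock Definition diffop_zero (F : fieldType) : diffop F :=
  0 : {malg {poly F}[int]}.
HB.lock Definition diffop_opp (F : fieldType) (x : diffop F) : diffop F :=
  - (x : {malg {poly F}[int]}).
HB.lock Definition diffop_add (F : fieldType) (x y : diffop F) : diffop F :=
  (x : {malg {poly F}[int]}) + y.
HB.lock Definition diffop_scale (F : fieldType) (c : F) (x : diffop F) :
  diffop F := (c%:P : {poly F}) *: (x : {malg {poly F}[int]}).

(* t^k f(D) *)
HB.lock Definition tpow (F : fieldType) (k : int) (f : {poly F}) : diffop F :=
  << f *g k >>.

Section DiffOpLmodule.
Variable F : fieldType.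

Fact diffop_addA : associative (@diffop_add F).
Proof. by move=> x y z; rewrite !diffop_add.unlock; exact: addrA. Qed.

Fact diffop_addC : commutative (@diffop_add F).
Proof. by move=> x y; rewrite !diffop_add.unlock; exact: addrC. Qed.

Fact diffop_add0 : left_id (diffop_zero F) (@diffop_add F).
Proof.
by move=> x; rewrite diffop_add.unlock diffop_zero.unlock; exact: add0r.
Qed.

Fact diffop_addN : left_inverse (diffop_zero F) (@diffop_opp F) (@diffop_add F).
Proof.
move=> x; rewrite diffop_add.unlock diffop_zero.unlock diffop_opp.unlock.
exact: addNr.
Qed.

HB.instance Definition _ := Choice.on (diffop F).
HB.instance Definition _ := GRing.isZmodule.Build (diffop F)
  diffop_addA diffop_addC diffop_add0 diffop_addN.

Fact diffop_scaleA (c d : F) (x : diffop F) :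
  diffop_scale c (diffop_scale d x) = diffop_scale (c * d) x.
Proof. by rewrite diffop_scale.unlock scalerA polyCM. Qed.

Fact diffop_scale1 : left_id 1 (@diffop_scale F).
Proof. by move=> x; rewrite diffop_scale.unlock scale1r. Qed.

Fact diffop_scaleDr : right_distributive (@diffop_scale F) +%R.
Proof.
move=> c x y; rewrite diffop_scale.unlock.
by rewrite /+%R /= diffop_add.unlock; exact: scalerDr.
Qed.

Fact diffop_scaleDl (x : diffop F) :
  {morph (@diffop_scale F)^~ x : c d / c + d}.
Proof.
move=> c d; rewrite diffop_scale.unlock polyCD.
by rewrite [in RHS]/+%R /= diffop_add.unlock; exact: scalerDl.
Qed.

HB.instance Definition _ := GRing.Zmodule_isLmodule.Build F (diffop F)
  diffop_scaleA diffop_scale1 diffop_scaleDr diffop_scaleDl.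

Definition dcoef (k : int) (x : diffop F) : {poly F} :=
  mcoeff k (x : {malg {poly F}[int]}).

Lemma diffopP (x y : diffop F) : (forall k, dcoef k x = dcoef k y) <-> x = y.
Proof. exact: malgP. Qed.

Lemma diffopDE (x y : diffop F) : x + y = (x : {malg {poly F}[int]}) + y.
Proof. by rewrite -[LHS]/(diffop_add x y) diffop_add.unlock. Qed.

Lemma diffop0E : 0 = (0 : {malg {poly F}[int]}) :> diffop F.
Proof. by rewrite -[LHS]/(diffop_zero F) diffop_zero.unlock. Qed.

Lemma dcoefD k x y : dcoef k (x + y) = dcoef k x + dcoef k y.
Proof. by rewrite diffopDE; exact: mcoeffD. Qed.

Lemma dcoef0 k : dcoef k 0 = 0.
Proof. by rewrite diffop0E; exact: mcoeff0. Qed.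

Lemma dcoefN k x : dcoef k (- x) = - dcoef k x.
Proof. by apply/eqP; rewrite -addr_eq0 -dcoefD addNr dcoef0. Qed.

Lemma dcoefZ k c x : dcoef k (c *: x) = c%:P * dcoef k x.
Proof.
rewrite -[c *: x]/(diffop_scale c x) diffop_scale.unlock; exact: mcoeffZ.
Qed.

Lemma dcoef_tpow j k f : dcoef j (tpow k f) = f *+ (k == j).
Proof. by rewrite tpow.unlock; exact: mcoeffU. Qed.

End DiffOpLmodule.

Section DiffOp.
Variable F : fieldType.
Implicit Types (f g h : {poly F}) (r s k : int) (x y z : diffop F).

(* f(w + s) *)
Definition shift s f : {poly F} := f \Po ('X + s%:~R%:P).

Definition diffop_lieb : diffop F -> diffop F -> diffop F :=
  biext (fun r s f g => tpow (r + s) (shift s f * g - f * shift r g)).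

(* i stands for - m *)
Definition psi_ge0 (r : nat) f g : F :=
  \sum_(1 <= i < r.+1) f.[- i%:R] * g.[- i%:R + r%:R].

(* The case r < 0 is given by skew-symmetry. *)
Definition psi r s f g : F :=
  if r + s == 0 then
    match r with
    | Posz n => psi_ge0 n f g
    | Negz n => - psi_ge0 n.+1 g f
    end
  else 0.

Definition diffop_psi : diffop F -> diffop F -> F^o := biext psi.

Lemma shiftD s f g : shift s (f + g) = shift s f + shift s g.
Proof. exact: comp_polyD. Qed.

Lemma shiftB s f g : shift s (f - g) = shift s f - shift s g.
Proof. exact: comp_polyB. Qed.

Lemma shiftM s f g : shift s (f * g) = shift s f * shift s g.
Proof. exact: comp_polyM. Qed.

Lemma shiftC s c : shift s c%:P = c%:P.
Proof. exact: comp_polyC. Qed.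

Lemma shift_shift r s f : shift r (shift s f) = shift (r + s) f.
Proof.
rewrite /shift -comp_polyA comp_polyD comp_polyX comp_polyC -addrA -polyCD.
by rewrite -intrD.
Qed.

Lemma horner_shift s f c : (shift s f).[c] = f.[c + s%:~R].
Proof. by rewrite horner_comp !hornerE. Qed.

Lemma diffop_monomial_ind (P : diffop F -> Prop) :
  P 0 -> (forall x y, P x -> P y -> P (x + y)) ->
  (forall k f, P (tpow k f)) -> forall x, P x.
Proof.
rewrite diffop0E tpow.unlock => P0 PD PU; apply: malg_monomial_ind => //.
by move=> x y; rewrite -diffopDE; apply: PD.
Qed.

Lemma tpowD k f g : tpow k (f + g) = tpow k f + tpow k g.
Proof. by apply/diffopP => j; rewrite dcoefD !dcoef_tpow mulrnDl. Qed.

Lemma tpowN k f : tpow k (- f) = - tpow k f.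
Proof. by apply/diffopP => j; rewrite dcoefN !dcoef_tpow mulNrn. Qed.

Lemma tpowZ k c f : tpow k (c%:P * f) = c *: tpow k f.
Proof. by apply/diffopP => j; rewrite dcoefZ !dcoef_tpow mulrnAr. Qed.

Lemma tpow0 k : tpow k 0 = 0 :> diffop F.
Proof. by apply/diffopP => j; rewrite dcoef0 !dcoef_tpow mul0rn. Qed.

Let bbDl r s f f' g :
  tpow (r + s) (shift s (f + f') * g - (f + f') * shift r g) =
  tpow (r + s) (shift s f * g - f * shift r g)
  + tpow (r + s) (shift s f' * g - f' * shift r g).
Proof. by rewrite -tpowD shiftD; congr tpow; ring. Qed.

Let bbDr r s f g g' :
  tpow (r + s) (shift s f * (g + g') - f * shift r (g + g')) =
  tpow (r + s) (shift s f * g - f * shift r g)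
  + tpow (r + s) (shift s f * g' - f * shift r g').
Proof. by rewrite -tpowD shiftD; congr tpow; ring. Qed.

Lemma diffop_liebDl x x' y :
  diffop_lieb (x + x') y = diffop_lieb x y + diffop_lieb x' y.
Proof.
by rewrite [X in diffop_lieb X]diffopDE; exact: (biextDl bbDl bbDr).
Qed.

Lemma diffop_liebDr x y y' :
  diffop_lieb x (y + y') = diffop_lieb x y + diffop_lieb x y'.
Proof.
by rewrite [X in diffop_lieb _ X]diffopDE; exact: (biextDr bbDl bbDr).
Qed.

Lemma diffop_liebU r s f g :
  diffop_lieb (tpow r f) (tpow s g) =
  tpow (r + s) (shift s f * g - f * shift r g).
Proof.
by rewrite [in LHS]tpow.unlock /diffop_lieb (biextU bbDl bbDr).
Qed.

Lemma diffop_lieb0l y : diffop_lieb 0 y = 0.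
Proof. by rewrite [in X in X = _]diffop0E; exact: biext0l. Qed.

Lemma diffop_lieb0r x : diffop_lieb x 0 = 0.
Proof. by rewrite [in X in X = _]diffop0E; exact: biext0r. Qed.

Lemma psiDl r s f f' g : psi r s (f + f') g = psi r s f g + psi r s f' g.
Proof.
rewrite /psi /psi_ge0; case: ifP => _; last by rewrite addr0.
case: r => n; rewrite -?opprD -big_split /=; [|congr (- _)];
  by apply: eq_bigr => i _; rewrite hornerD ?mulrDl ?mulrDr.
Qed.

Lemma psiDr r s f g g' : psi r s f (g + g') = psi r s f g + psi r s f g'.
Proof.
rewrite /psi /psi_ge0; case: ifP => _; last by rewrite addr0.
case: r => n; rewrite -?opprD -big_split /=; [|congr (- _)];
  by apply: eq_bigr => i _; rewrite hornerD ?mulrDl ?mulrDr.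
Qed.

Lemma diffop_psiDl x x' y :
  diffop_psi (x + x') y = diffop_psi x y + diffop_psi x' y.
Proof. by rewrite diffopDE; exact: (biextDl psiDl psiDr). Qed.

Lemma diffop_psiDr x y y' :
  diffop_psi x (y + y') = diffop_psi x y + diffop_psi x y'.
Proof. by rewrite diffopDE; exact: (biextDr psiDl psiDr). Qed.

Lemma diffop_psiU r s f g : diffop_psi (tpow r f) (tpow s g) = psi r s f g.
Proof. by rewrite tpow.unlock; exact: (biextU psiDl psiDr). Qed.

Lemma diffop_psi0l y : diffop_psi 0 y = 0.
Proof. by rewrite [in X in X = _]diffop0E; exact: biext0l. Qed.

Lemma diffop_psi0r x : diffop_psi x 0 = 0.
Proof. by rewrite [in X in X = _]diffop0E; exact: biext0r. Qed.

Lemma diffop_liebZl c x y : diffop_lieb (c *: x) y = c *: diffop_lieb x y.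
Proof.
elim/diffop_monomial_ind: x => [|x x' IH IH'|r f].
- by rewrite scaler0 diffop_lieb0l scaler0.
- by rewrite scalerDr !diffop_liebDl IH IH' scalerDr.
elim/diffop_monomial_ind: y => [|y y' IH IH'|s g].
- by rewrite !diffop_lieb0r scaler0.
- by rewrite !diffop_liebDr IH IH' scalerDr.
rewrite -tpowZ !diffop_liebU -tpowZ shiftM shiftC; congr tpow; ring.
Qed.

Lemma diffop_liebC x y : diffop_lieb x y = - diffop_lieb y x.
Proof.
elim/diffop_monomial_ind: x => [|x x' IH IH'|r f].
- by rewrite diffop_lieb0l diffop_lieb0r oppr0.
- by rewrite diffop_liebDl diffop_liebDr IH IH' opprD.
elim/diffop_monomial_ind: y => [|y y' IH IH'|s g].
- by rewrite diffop_lieb0l diffop_lieb0r oppr0.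
- by rewrite diffop_liebDl diffop_liebDr IH IH' opprD.
rewrite !diffop_liebU -tpowN [s + r]addrC; congr tpow; ring.
Qed.

Lemma diffop_liebZr c x y : diffop_lieb x (c *: y) = c *: diffop_lieb x y.
Proof. by rewrite diffop_liebC diffop_liebZl diffop_liebC scalerN opprK. Qed.

Lemma diffop_liebxx x : diffop_lieb x x = 0.
Proof.
elim/diffop_monomial_ind: x => [|x y IHx IHy|r f].
- exact: diffop_lieb0l.
- rewrite diffop_liebDl !diffop_liebDr IHx IHy (diffop_liebC x).
  by rewrite add0r addr0 addNr.
- by rewrite diffop_liebU mulrC subrr tpow0.
Qed.

Let addr3ACA (V : zmodType) (a a' b b' c c' : V) :
  (a + a') + (b + b') + (c + c') = (a + b + c) + (a' + b' + c').
Proof. by rewrite (addrACA a) (addrACA (a + b)). Qed.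

Lemma diffop_lieb_jacobi x y z :
  diffop_lieb x (diffop_lieb y z) + diffop_lieb y (diffop_lieb z x)
  + diffop_lieb z (diffop_lieb x y) = 0.
Proof.
elim/diffop_monomial_ind: x => [|x x' IH IH'|r f].
- by rewrite !(diffop_lieb0l, diffop_lieb0r) !addr0.
- rewrite !(diffop_liebDl, diffop_liebDr).
  by rewrite addr3ACA IH IH' addr0.
elim/diffop_monomial_ind: y => [|y y' IH IH'|s g].
- by rewrite !(diffop_lieb0l, diffop_lieb0r) !addr0.
- rewrite !(diffop_liebDl, diffop_liebDr).
  by rewrite addr3ACA IH IH' addr0.
elim/diffop_monomial_ind: z => [|z z' IH IH'|u h].
- by rewrite !(diffop_lieb0l, diffop_lieb0r) !addr0.
- rewrite !(diffop_liebDl, diffop_liebDr).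
  by rewrite addr3ACA IH IH' addr0.
rewrite !diffop_liebU.
rewrite (_ : s + (u + r) = r + (s + u)); last by ring.
rewrite (_ : u + (r + s) = r + (s + u)); last by ring.
rewrite -!tpowD -[RHS](tpow0 (r + (s + u))); congr tpow.
rewrite !(shiftB, shiftM, shift_shift) ![u + r]addrC ![u + s]addrC ![s + r]addrC.
ring.
Qed.

(* Sum of p over [0, b), with a sign if b < 0. *)
Let isum (p : int -> F) (b : int) : F :=
  match b with
  | Posz n => \sum_(i < n) p i
  | Negz n => - \sum_(i < n.+1) p (Negz i)
  end.

Let isum0 p : isum p 0 = 0.
Proof. exact: big_ord0. Qed.

Let isumS (p : int -> F) b : isum p (b + 1) = isum p b + p b.
Proof.
case: b => [n|[|n]].
- by rewrite -PoszD addn1 /= big_ord_recr.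
- by rewrite /= big_ord0 big_ord_recr big_ord0 /= add0r addNr.
- rewrite (_ : Negz n.+1 + 1 = Negz n); last by lia.
  by rewrite /= [in RHS]big_ord_recr /= opprD addrNK.
Qed.

Let isum_eq (p q : int -> F) b : p =1 q -> isum p b = isum q b.
Proof. by move=> pq; case: b => n /=; [|congr (- _)]; apply: eq_bigr. Qed.

Let isumB (p q : int -> F) b :
  isum (fun m => p m - q m) b = isum p b - isum q b.
Proof. by case: b => n; rewrite /= sumrB // opprD. Qed.

Let isumN (p : int -> F) b : isum (fun m => - p m) b = - isum p b.
Proof. by case: b => n; rewrite /= sumrN. Qed.

Let isum_shift (p : int -> F) s b :
  isum (fun m => p (m + s)) b = isum p (b + s) - isum p s.
Proof.
elim/int_rec: b => [|n IH|n IH].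
- by rewrite add0r subrr isum0.
- rewrite -addn1 PoszD isumS IH (_ : n%:Z + 1 + s = n%:Z + s + 1); last by ring.
  by rewrite isumS addrAC.
- apply: (addIr (p (- n.+1%:Z + s))).
  rewrite -(isumS (fun m => p (m + s))).
  rewrite (_ : - n.+1%:Z + 1 = - n%:Z); last by lia.
  rewrite IH addrAC -isumS; congr (isum _ _ - _); lia.
Qed.

Let psiE r s f g : r + s = 0 ->
  psi r s f g = - isum (fun m => f.[m%:~R] * g.[(m + r)%:~R]) (- r).
Proof.
move=> rs; rewrite /psi rs eqxx; case: r {rs} => n.
  case: n => [|n]; first by rewrite oppr0 isum0 oppr0 /psi_ge0 big_geq.
  rewrite -NegzE /= opprK /psi_ge0 big_add1 big_mkord; apply: eq_bigr => i _.
  by rewrite NegzE intrD mulrNz.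
rewrite NegzE opprK /=; congr (- _).
rewrite /psi_ge0 big_add1 big_mkord (reindex_inj rev_ord_inj) /=.
apply: eq_bigr => i _; rewrite mulrC.
have iE : - (n.+1 - i.+1).+1%:Z + n.+1%:Z = i by have := ltn_ord i; lia.
have iE' : - (n.+1 - i.+1).+1%:Z = i%:Z - n.+1%:Z by rewrite -iE addrK.
by rewrite -iE' -[in RHS]iE intrD mulrNz.
Qed.

Let psi0 r s f g : r + s != 0 -> psi r s f g = 0.
Proof. by rewrite /psi => /negPf ->. Qed.

Lemma diffop_psiC x y : diffop_psi x y = - diffop_psi y x.
Proof.
elim/diffop_monomial_ind: x => [|x x' IH IH'|r f].
- by rewrite diffop_psi0l diffop_psi0r oppr0.
- by rewrite diffop_psiDl diffop_psiDr IH IH' opprD.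
elim/diffop_monomial_ind: y => [|y y' IH IH'|s g].
- by rewrite diffop_psi0l diffop_psi0r oppr0.
- by rewrite diffop_psiDl diffop_psiDr IH IH' opprD.
rewrite !diffop_psiU; have [rs|rs] := eqVneq (r + s) 0; last first.
  by rewrite !psi0 ?[s + r]addrC // oppr0.
rewrite !psiE ?[s + r]addrC // opprK.
pose p m := f.[m%:~R] * g.[(m + r)%:~R].
rewrite (@isum_eq (fun m => g.[_] * _) (fun m => p (m + s))) => [|m]; last first.
  have mE : m + s + r = m by lia.
  by rewrite /p mE mulrC.
rewrite isum_shift addNr isum0 sub0r; congr (- isum _ _).
by apply/eqP; rewrite -subr_eq0 -opprD rs oppr0.
Qed.

Lemma diffop_psixx x : diffop_psi x x = 0.
Proof.
elim/diffop_monomial_ind: x => [|x y IHx IHy|r f].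
- exact: diffop_psi0l.
- rewrite diffop_psiDl !diffop_psiDr IHx IHy (diffop_psiC x).
  by rewrite add0r addr0 addNr.
rewrite diffop_psiU; have [rr|rr] := eqVneq (r + r) 0; last by rewrite psi0.
by rewrite psiE // (_ : r = 0) ?oppr0 ?isum0 ?oppr0 //; lia.
Qed.

Lemma diffop_psiZl c x y : diffop_psi (c *: x) y = c *: diffop_psi x y.
Proof.
elim/diffop_monomial_ind: x => [|x x' IH IH'|r f].
- by rewrite scaler0 diffop_psi0l scaler0.
- by rewrite scalerDr !diffop_psiDl IH IH' scalerDr.
elim/diffop_monomial_ind: y => [|y y' IH IH'|s g].
- by rewrite !diffop_psi0r scaler0.
- by rewrite !diffop_psiDr IH IH' scalerDr.
rewrite -tpowZ !diffop_psiU; have [rs|rs] := eqVneq (r + s) 0; last first.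
  by rewrite !psi0 // scaler0.
rewrite !psiE // scalerN; congr (- _).
by case: (- r) => n /=; rewrite ?scalerN scaler_sumr; [|congr (- _)];
  apply: eq_bigr => i _; rewrite hornerM hornerC -mulrA.
Qed.

Lemma diffop_psiZr c x y : diffop_psi x (c *: y) = c *: diffop_psi x y.
Proof. by rewrite diffop_psiC diffop_psiZl diffop_psiC scalerN opprK. Qed.

Let psi_lieb r s u f g h : r + (s + u) = 0 ->
  psi r (s + u) f (shift u g * h - g * shift s h) =
  isum (fun m => f.[m%:~R] * g.[(m + r)%:~R] * h.[(m + r + s)%:~R]) (- r)
  - isum (fun m => f.[m%:~R] * g.[(m + r + u)%:~R] * h.[(m + r)%:~R]) (- r).
Proof.
move=> rsu; rewrite psiE // -isumN -isumB; apply: isum_eq => m.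
rewrite hornerD hornerN !hornerM !horner_shift -!intrD; ring.
Qed.

Lemma diffop_psi_jacobi x y z :
  diffop_psi x (diffop_lieb y z) + diffop_psi y (diffop_lieb z x)
  + diffop_psi z (diffop_lieb x y) = 0.
Proof.
elim/diffop_monomial_ind: x => [|x x' IH IH'|r f].
- by rewrite !(diffop_lieb0l, diffop_lieb0r, diffop_psi0l, diffop_psi0r) !addr0.
- rewrite !(diffop_liebDl, diffop_liebDr, diffop_psiDl, diffop_psiDr).
  by rewrite addr3ACA IH IH' addr0.
elim/diffop_monomial_ind: y => [|y y' IH IH'|s g].
- by rewrite !(diffop_lieb0l, diffop_lieb0r, diffop_psi0l, diffop_psi0r) !addr0.
- rewrite !(diffop_liebDl, diffop_liebDr, diffop_psiDl, diffop_psiDr).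
  by rewrite addr3ACA IH IH' addr0.
elim/diffop_monomial_ind: z => [|z z' IH IH'|u h].
- by rewrite !(diffop_lieb0l, diffop_lieb0r, diffop_psi0l, diffop_psi0r) !addr0.
- rewrite !(diffop_liebDl, diffop_liebDr, diffop_psiDl, diffop_psiDr).
  by rewrite addr3ACA IH IH' addr0.
rewrite !diffop_liebU !diffop_psiU.
have [rsu|rsu] := eqVneq (r + (s + u)) 0; last first.
  by rewrite !psi0 ?addr0 //; apply: contra_neq rsu; lia.
rewrite !psi_lieb; try lia.
pose p m := f.[m%:~R] * g.[(m + r)%:~R] * h.[(m + r + s)%:~R].
pose q m := f.[m%:~R] * g.[(m + r + u)%:~R] * h.[(m + r)%:~R].
have pE a b c k : a = k -> b = k + r -> c = k + r + s ->
    f.[a%:~R] * g.[b%:~R] * h.[c%:~R] = p k by move=> -> -> ->.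
have qE a b c k : a = k -> b = k + r + u -> c = k + r ->
    f.[a%:~R] * g.[b%:~R] * h.[c%:~R] = q k by move=> -> -> ->.
have -> : isum (fun m => g.[m%:~R] * h.[(m + s)%:~R] * f.[(m + s + u)%:~R]) (- s)
    = isum p (- s + (s + u)) - isum p (s + u).
  by rewrite -isum_shift; apply: isum_eq => m; rewrite -(pE (m + s + u) m (m + s));
    [ring|lia..].
have -> : isum (fun m => g.[m%:~R] * h.[(m + s + r)%:~R] * f.[(m + s)%:~R]) (- s)
    = isum q (- s + s) - isum q s.
  by rewrite -isum_shift; apply: isum_eq => m; rewrite -(qE (m + s) m (m + s + r));
    [ring|lia..].
have -> : isum (fun m => h.[m%:~R] * f.[(m + u)%:~R] * g.[(m + u + r)%:~R]) (- u)
    = isum p (- u + u) - isum p u.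
  by rewrite -isum_shift; apply: isum_eq => m; rewrite -(pE (m + u) (m + u + r) m);
    [ring|lia..].
have -> : isum (fun m => h.[m%:~R] * f.[(m + u + s)%:~R] * g.[(m + u)%:~R]) (- u)
    = isum q (- u + (u + s)) - isum q (u + s).
  by rewrite -isum_shift; apply: isum_eq => m; rewrite -(qE (m + u + s) (m + u) m);
    [ring|lia..].
have e1 : - s + (s + u) = u by lia.
have e2 : - u + (u + s) = s by lia.
have e3 : s + u = - r by lia.
by rewrite e1 e2 e3 [u + s]addrC e3 !addNr !isum0; ring.
Qed.

End DiffOp.

(* D-hat = D (+) F.C : the pair (x, c) is x + c C. *)
Definition hatD (F : fieldType) := (diffop F * F^o)%type.

Section HatD.
Variable F : fieldType.

HB.instance Definition _ := GRing.Lmodule.on (hatD F).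

Definition hatD_lieb (x y : hatD F) : hatD F :=
  (diffop_lieb x.1 y.1, diffop_psi x.1 y.1).

Fact hatD_liebDl x y z : hatD_lieb (x + y) z = hatD_lieb x z + hatD_lieb y z.
Proof. by rewrite /hatD_lieb diffop_liebDl diffop_psiDl. Qed.

Fact hatD_liebDr x y z : hatD_lieb x (y + z) = hatD_lieb x y + hatD_lieb x z.
Proof. by rewrite /hatD_lieb diffop_liebDr diffop_psiDr. Qed.

Fact hatD_liebZl a x y : hatD_lieb (a *: x) y = a *: hatD_lieb x y.
Proof. by rewrite /hatD_lieb diffop_liebZl diffop_psiZl. Qed.

Fact hatD_liebZr a x y : hatD_lieb x (a *: y) = a *: hatD_lieb x y.
Proof. by rewrite /hatD_lieb diffop_liebZr diffop_psiZr. Qed.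

Fact hatD_liebxx x : hatD_lieb x x = 0.
Proof. by rewrite /hatD_lieb diffop_liebxx diffop_psixx. Qed.

Fact hatD_lieb_jacobi x y z :
  hatD_lieb x (hatD_lieb y z) + hatD_lieb y (hatD_lieb z x)
  + hatD_lieb z (hatD_lieb x y) = 0.
Proof.
have := diffop_lieb_jacobi x.1 y.1 z.1; have := diffop_psi_jacobi x.1 y.1 z.1.
by rewrite /hatD_lieb => psi0 lie0; congr (_, _).
Qed.

HB.instance Definition _ := Lmodule_isLie.Build F (hatD F)
  hatD_liebDl hatD_liebDr hatD_liebZl hatD_liebZr hatD_liebxx hatD_lieb_jacobi.

(* t^k f(D) and the central element C in D-hat *)
Definition tD (k : int) (f : {poly F}) : hatD F := (tpow k f, 0).
Definition CC : hatD F := (0, 1).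

Lemma lieb_tD r s f g : lieb (tD r f) (tD s g) =
  tD (r + s) (shift s f * g - f * shift r g) + psi r s f g *: CC.
Proof.
rewrite /tD /CC -diffop_liebU -diffop_psiU.
apply/eqP; rewrite xpair_eqE /= scaler0 addr0 add0r eqxx /=.
by rewrite /( *:%R) /= mulr1.
Qed.

Lemma lieb_CC x : lieb CC x = 0.
Proof. by rewrite /lieb /= /hatD_lieb diffop_lieb0l diffop_psi0l. Qed.

(* [w]_n *)
Definition ffall (n : nat) : {poly F} := \prod_(i < n) ('X - i%:R%:P).

(* The homogeneous component of degree j of W_oo^(n). *)
Definition Winf (n : nat) (j : int) : set (hatD F) :=
  [set x | exists (f : {poly F}) (c : F),
     x = tD j (f * ffall n) + (c *+ (j == 0)) *: CC].

Lemma Winf_graded n : graded_lie_subalgebra (Winf n).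
Proof.
split=> [j|i j x y [f [c ->]] [g [e ->]]|s x us Wx x0 j js].
- split=> [|a u v [f [c ->]] [g [e ->]]].
    exists 0, 0; rewrite mul0rn scale0r addr0 mul0r /tD tpow0.
    by [].
  exists (a *: f + g), (a * c + e).
  rewrite mulrDl -scalerAl mulrnDl scalerDl -mulrnAr -scalerA scalerDr.
  rewrite addrACA; congr (_ + _).
  by congr (_, _); rewrite /= ?scaler0 ?addr0 // tpowD -mul_polyC tpowZ.
- rewrite liebDl !liebDr !liebZl !liebZr !lieb_CC (liebC _ CC) lieb_CC.
  rewrite oppr0 !scaler0 !addr0 lieb_tD.
  exists (shift j (f * ffall n) * g - f * shift i (g * ffall n)).
  exists (psi i j (f * ffall n) (g * ffall n)).
  congr (tD _ _ + _ *: _); first by ring.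
  by rewrite /psi; case: eqP; rewrite ?mulr1n ?mul0rn.
have x1 k l : k != l -> dcoef l (x k).1 = 0.
  have [f [c ->]] := Wx k => /negPf kl.
  by rewrite dcoefD dcoefZ dcoef_tpow kl dcoef0 mulr0 addr0.
have x2 k : k != 0 -> (x k).2 = 0.
  by have [f [c ->]] := Wx k => /negPf ->; rewrite /= scale0r addr0.
have sum1 l : dcoef l (\sum_(k <- s) x k).1 = \sum_(k <- s) dcoef l (x k).1.
  rewrite raddf_sum; apply: (big_morph (dcoef l)); last exact: dcoef0.
  exact: dcoefD.
have sum2 : (\sum_(k <- s) x k).2 = \sum_(k <- s) (x k).2.
  exact: (raddf_sum snd).
rewrite [x j]surjective_pairing; congr (_, _).
  apply/diffopP => l; rewrite dcoef0; have [jl|/x1//] := eqVneq j l.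
  have := sum1 l; rewrite x0 dcoef0 (bigD1_seq j) //= big1 ?addr0 -?jl // => k kj.
  exact: x1.
have [j0|/x2//] := eqVneq j 0.
have := sum2; rewrite x0 (bigD1_seq j) //= big1 ?addr0 // => k kj.
by apply: x2; rewrite -j0.
Qed.

End HatD.

Arguments ffall {F} n.
Arguments CC {F}.

(* Main.v *)
Require Import Defs.
From mathcomp Require Import all_boot all_order all_algebra.
From mathcomp Require Import classical_sets reals complex.
From mathcomp Require Import zify ring.

(** The bracket of t^r f(D) and t^s g(D) is t^(r+s) h(D), up to the centre, with
    h(w) = f(w+s) g(w) - f(w) g(w+r). The leading terms of the two products
    cancel, and for deg f = p, deg g = q the coefficient of w^(p+q-1) in h is
    (p s - q r) lc(f) lc(g). Hence in characteristic zero h has degree exactly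
    p+q-1 as soon as p s <> q r ([size_comm_coef]), and nondegeneracy becomes
    a matter of counting degrees.

    Let P be a parabolic subalgebra of W = W_oo^(n), n >= 1. For j < 0 the
    component P_j consists of elements t^j f(D), where f is divisible by [w]_n
    and so has degree at least n > 0 when it is nonzero.
    - P_(-1) is nonzero: a nonzero element of P_j with j < 0, bracketed with the
      element t^(-j-1) [D]_n of nonnegative degree, gives a nonzero element of
      P_(-1) ([symbols_m1_neq0]).
    - All sufficiently large degrees occur among the f with t^(-1) f(D) in
      P_(-1), by bracketing a fixed nonzero element of P_(-1) with the
      D^i [D]_n in W_0. Bracketing the same element with P_(-k) carries this
      property from P_(-k) to P_(-k-1) ([symbols_neg_degrees]).
    - A subspace of polynomials containing an element of every large degree has
      finite codimension, by division ([all_degrees_ge_reduce]).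
    So every parabolic subalgebra is nondegenerate, and in particular so is the
    one generated by a nonzero d in W_(-1).

    For the description of [W_1, t^(-1) b(D)], write the elements of W_1 as
    t g(D+1) [D]_n and compute ([lieb_degree1]). The cocycle term is a multiple
    of b(0), and b(0) = 0 because [w]_n divides b and n >= 1. *)

Set Implicit Arguments.
Unset Strict Implicit.
Unset Printing Implicit Defensive.

Import Order.TTheory GRing.Theory Num.Theory.
Local Open Scope classical_set_scope.
Local Open Scope ring_scope.
Local Open Scope complex_scope.

(** * The degree of a commutator *)

Definition comm_coef (F : fieldType) (r s : int) (f g : {poly F}) : {poly F} :=
  shift s f * g - f * shift r g.

(** Taylor's formula f(w+s) = f(w) + s f'(w) + ..., in which the divided
    derivative of order i has degree at most deg f - i. *)
Lemma size_shift_rem (F : fieldType) (s : int) (f : {poly F}) :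
  (size (shift s f - (f + s%:~R *: f^`()))%R <= (size f).-2)%N.
Proof.
have cX : GRing.comm 'X (s%:~R%:P : {poly F}) by apply: mulrC.
have -> : shift s f = \sum_(i < (size f).-2.+2) (s%:~R ^+ i) *: f^`N(i).
  rewrite /shift /comp_poly (nderiv_taylor_wide (n := (size f).-2.+2) cX) //.
    apply: eq_bigr => i _; rewrite nderivn_map -/(comp_poly _ _) comp_polyXr.
    by rewrite -polyC_exp mulrC mul_polyC.
  by rewrite size_map_polyC; lia.
rewrite !big_ord_recl nderivn0 nderivn1 expr0 expr1 scale1r /=.
rewrite addrA [_ + _ + \sum_(_ < _) _]addrC addrK.
apply: (leq_trans (size_sum _ _ _)); apply/bigmax_leqP => i _.
apply: (leq_trans (size_scale_leq _ _)); apply/leq_sizeP => j ij.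
by rewrite coef_nderivn nth_default ?mul0rn // /bump /=; lia.
Qed.

(** Modulo terms of degree less than p+q-1 the commutator coefficient is
    s f' g - r f g', since the product f g cancels. *)
Lemma size_comm_coef (F : numFieldType) (r s : int) (p q : nat)
    (f g : {poly F}) :
  (0 < p)%N -> (0 < q)%N -> size f = p.+1 -> size g = q.+1 ->
  p%:Z * s - q%:Z * r != 0 -> size (comm_coef r s f g) = (p + q)%N.
Proof.
move=> p0 q0 sf sg pq.
set u := shift s f - (f + s%:~R *: f^`()).
set v := shift r g - (g + r%:~R *: g^`()).
have su : (size u <= p.-1)%N by have := size_shift_rem s f; rewrite sf.
have sv : (size v <= q.-1)%N by have := size_shift_rem r g; rewrite sg.
pose h := s%:~R *: (f^`() * g) - r%:~R *: (f * g^`()) + (u * g - f * v).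
have -> : comm_coef r s f g = h.
  by rewrite /comm_coef /h /u /v -!mul_polyC; ring.
have szM (a b : {poly F}) x y : (size a <= x.+1)%N -> (size b <= y)%N ->
    (size (a * b)%R <= x + y)%N.
  by move=> ax b_y; apply: leq_trans (size_polyMleq _ _) _; lia.
have sdf : (size f^`() <= p)%N.
  by rewrite -ltnS -sf lt_size_deriv // -size_poly_eq0 sf.
have sdg : (size g^`() <= q)%N.
  by rewrite -ltnS -sg lt_size_deriv // -size_poly_eq0 sg.
have suv : (size (u * g - f * v)%R <= (p + q).-1)%N.
  rewrite (leq_trans (size_polyD _ _)) // size_polyN geq_max [u * g]mulrC.
  apply/andP; split; [apply: leq_trans (szM g u q p.-1 _ su) _
                     |apply: leq_trans (szM f v p q.-1 _ sv) _];
    by rewrite ?sf ?sg //; lia.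
have sh : (size h <= p + q)%N.
  rewrite (leq_trans (size_polyD _ _)) // geq_max (leq_trans suv) ?leq_pred //.
  rewrite andbT (leq_trans (size_polyD _ _)) // size_polyN geq_max.
  apply/andP; split; rewrite (leq_trans (size_scale_leq _ _)) //.
    by rewrite mulrC addnC; apply: szM; rewrite ?sg.
  by apply: szM; rewrite ?sf.
apply/eqP; rewrite eqn_leq sh /= leqNgt; apply/negP => lt_h.
have : h`_(p + q).-1 = 0.
  by apply: nth_default; rewrite -ltnS prednK ?addn_gt0 ?p0.
have coefM_top (a b : {poly F}) x y : (size a <= x.+1)%N ->
    (size b <= y.+1)%N -> (a * b)`_(x + y) = a`_x * b`_y.
  move=> ax b_y; rewrite coefM (bigD1 (@inord (x + y) x)) //=.
  rewrite inordK ?ltnS ?leq_addr // addKn big1 ?addr0 // => i.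
  rewrite -val_eqE /= inordK ?ltnS ?leq_addr // => ix.
  have [ltix|xi] := ltnP i x.
    by rewrite [b`__]nth_default ?mulr0 //; apply: leq_trans b_y _; lia.
  by rewrite [a`__]nth_default ?mul0r //; apply: leq_trans ax _; lia.
rewrite coefD (nth_default _ suv) addr0 coefB !coefZ.
have -> : (f^`() * g)`_(p + q).-1 = f^`()`_p.-1 * g`_q.
  by rewrite -coefM_top ?sg ?prednK //; congr (_`_ _); lia.
have -> : (f * g^`())`_(p + q).-1 = f`_p * g^`()`_q.-1.
  by rewrite -coefM_top ?sf ?prednK //; congr (_`_ _); lia.
rewrite !coef_deriv !prednK //.
have fp : f`_p != 0.
  by rewrite -[p]/(p.+1.-1) -sf -lead_coefE lead_coef_eq0 -size_poly_eq0 sf.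
have gq : g`_q != 0.
  by rewrite -[q]/(q.+1.-1) -sg -lead_coefE lead_coef_eq0 -size_poly_eq0 sg.
have -> : s%:~R * (f`_p *+ p * g`_q) - r%:~R * (f`_p * (g`_q *+ q)) =
  (p%:Z * s - q%:Z * r)%:~R * (f`_p * g`_q) :> F.
  rewrite intrB !intrM -[f`_p *+ p]mulr_natr -[g`_q *+ q]mulr_natr; ring.
by move/eqP; rewrite !mulf_eq0 intr_eq0 (negPf pq) (negPf fp) (negPf gq).
Qed.

(** * Subspaces of polynomials containing all large degrees *)

Definition all_degrees_ge (F : fieldType) (A : set {poly F}) (M : nat) : Prop :=
  forall m, (M <= m)%N -> exists2 f, A f & size f = m.+1.

Lemma all_degrees_ge_reduce (F : fieldType) (A : set {poly F}) M v :
  subspace A -> all_degrees_ge A M -> exists2 u, A u & (size (v - u)%R <= M)%N.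
Proof.
move=> sA AM; have [k] := ubnP (size v); elim: k v => // k IH v vk.
have [vM|Mv] := leqP (size v) M; first by exists 0; [case: sA|rewrite subr0].
have [f Af sf] := AM (size v).-1 ltac:(lia).
have sfv : size f = size v by rewrite sf; lia.
pose c := lead_coef v / lead_coef f.
have f0 : lead_coef f != 0 by rewrite lead_coef_eq0 -size_poly_eq0 sfv; lia.
have sw : (size (v - c *: f)%R <= (size v).-1)%N.
  apply/leq_sizeP => j vj; rewrite coefB coefZ.
  have [->|jv] := eqVneq j (size v).-1.
    by rewrite -{2}sfv -!lead_coefE divfK ?subrr.
  have sj : (size v <= j)%N by move: vj jv; lia.
  by rewrite !nth_default ?sfv ?mulr0 ?subrr.
have [|u Au su] := IH (v - c *: f).
  by apply: leq_ltn_trans sw _; lia.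
exists (c *: f + u); first by apply: sA.2.
by rewrite opprD addrA.
Qed.

(** * Homogeneous elements *)

Section Homogeneous.
Variable F : fieldType.
Implicit Types (f g : {poly F}) (r s j : int).

Lemma size_ffall n : size (ffall n : {poly F}) = n.+1.
Proof. by rewrite /ffall size_prod_XsubC /index_enum -enumT size_enum_ord. Qed.

Lemma ffall_neq0 n : (ffall n : {poly F}) != 0.
Proof. by rewrite -size_poly_eq0 size_ffall. Qed.

Lemma horner_ffall0 n : (0 < n)%N -> (ffall n : {poly F}).[0] = 0.
Proof.
case: n => // n _; rewrite /ffall big_ord_recl hornerM.
by rewrite hornerXsubC subrr mul0r.
Qed.

Lemma tD_linear j c f g : tD j (c *: f + g) = c *: tD j f + tD j g.
Proof. by congr (_, _); rewrite /= ?scaler0 ?addr0 // tpowD -mul_polyC tpowZ. Qed.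

Lemma tD0 j : tD j (0 : {poly F}) = 0.
Proof. by rewrite /tD tpow0. Qed.

Lemma tDZ j c f : tD j (c *: f) = c *: tD j f.
Proof. by have := tD_linear j c f 0; rewrite tD0 !addr0. Qed.

Lemma tD_sum j M (f : 'I_M -> {poly F}) :
  tD j (\sum_(i < M) f i) = \sum_(i < M) tD j (f i).
Proof.
apply: (big_morph (tD j)) => [g h|]; last exact: tD0.
by rewrite -[g in LHS]scale1r tD_linear scale1r.
Qed.

Lemma dcoef_tD j f : dcoef j (tD j f).1 = f.
Proof. by rewrite dcoef_tpow eqxx. Qed.

Lemma lieb_tD_neq0 r s f g : r + s != 0 ->
  lieb (tD r f) (tD s g) = tD (r + s) (comm_coef r s f g).
Proof. by move=> rs; rewrite lieb_tD /psi (negPf rs) scale0r addr0. Qed.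

(** The cocycle contributes f(-1) b(0), so it vanishes together with b(0). The
    polynomial multiplying [w]_n is written g(w+1) to make g itself appear in
    the product f(w-1) b(w). *)
Lemma lieb_degree1 n (g b : {poly F}) : b.[0] = 0 ->
  lieb (tD 1 (shift 1 g * ffall n)) (tD (- 1) b) =
  tD 0 (shift (- 1) (ffall n) * g * b - ffall n * shift 1 g * shift 1 b).
Proof.
move=> b0; have psi0 f : psi 1 (- 1) f b = 0.
  by rewrite /psi subrr eqxx /= /psi_ge0 big_nat1 addNr b0 mulr0.
rewrite lieb_tD psi0 scale0r addr0; congr tD.
rewrite shiftM shift_shift addNr.
have -> : shift 0 g = g by rewrite /shift addr0 comp_polyXr.
by ring.
Qed.

Lemma Winf_tD n j f : Winf n j (tD j (f * ffall n)).
Proof. by exists f, 0; rewrite mul0rn scale0r addr0. Qed.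

Lemma Winf_neq0E n j x : j != 0 -> Winf n j x ->
  exists f, x = tD j (f * ffall n).
Proof. by move=> /negPf j0 [f [c ->]]; exists f; rewrite j0 scale0r addr0. Qed.

End Homogeneous.

Lemma subspace_image_lieb (F : fieldType) (L : lieAlgType F) (A : set L) d :
  subspace A -> subspace [set lieb x d | x in A].
Proof.
move=> [A0 sA]; split=> [|c _ _ [x Ax <-] [y Ay <-]].
  by exists 0; rewrite // lieb0l.
by exists (c *: x + y); [apply: sA|rewrite liebDl liebZl].
Qed.

(** * Parabolic subalgebras are nondegenerate *)

Section Parabolic.
Variables (F : numFieldType) (n : nat) (p : int -> set (hatD F)).
Hypotheses (n_gt0 : (0 < n)%N) (par_p : parabolic (@Winf F n) p).

Definition symbols (j : int) : set {poly F} := [set f | p j (tD j f)].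

Lemma subspace_symbols j : subspace (symbols j).
Proof.
have sp := pb_subspace par_p j; split=> [|c f g pf pg].
  by rewrite /symbols /= tD0; case: sp.
by rewrite /symbols /= tD_linear; apply: sp.2.
Qed.

Lemma symbols_dvd j f : j != 0 -> symbols j f -> exists h, f = h * ffall n.
Proof.
move=> j0 /(pb_sub par_p)/(Winf_neq0E j0)[h /(congr1 (fun x => dcoef j x.1))].
by rewrite !dcoef_tD => ->; exists h.
Qed.

Lemma symbols_degree j f : j != 0 -> symbols j f -> f != 0 ->
  exists2 q, (n <= q)%N & size f = q.+1.
Proof.
move=> j0 /(symbols_dvd j0)[h ->] hf0.
have h0 : h != 0 by apply: contraNneq hf0 => ->; rewrite mul0r.
exists ((size h).-1 + n)%N; first exact: leq_addl.
rewrite size_mul ?ffall_neq0 // size_ffall addnS /= -addSn prednK //.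
by rewrite size_poly_gt0.
Qed.

Lemma symbols_comm r s f g : r + s != 0 ->
  symbols r f -> symbols s g -> symbols (r + s) (comm_coef r s f g).
Proof.
move=> rs pf pg; rewrite /symbols /= -lieb_tD_neq0 //.
exact: (pb_lieb par_p).
Qed.

Lemma symbols_ge0 j h : 0 <= j -> symbols j (h * ffall n).
Proof. by move=> j0; rewrite /symbols /= (pb_ge0 par_p j0); apply: Winf_tD. Qed.

(** A nonzero f in degree j < 0, of degree q as a polynomial, is bracketed with
    t^(-j-1) [D]_n; the criterion of [size_comm_coef] holds because
    n j + q (j + 1) < 0. *)
Lemma symbols_m1_neq0 : exists2 f, symbols (- 1) f & f != 0.
Proof.
have [j [x [j0 px x0]]] := pb_neg par_p.
have jn0 : j != 0 by rewrite lt_eqF.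
have [h xE] := Winf_neq0E jn0 (pb_sub par_p px).
have pf : symbols j (h * ffall n) by rewrite /symbols /= -xE.
have f0 : h * ffall n != 0.
  by apply: contraNneq x0 => f0; rewrite xE f0 tD0.
have [q nq sf] := symbols_degree jn0 pf f0.
have pg : symbols (- j - 1) (1 * ffall n) by apply: symbols_ge0; lia.
have rsE : - j - 1 + j = - 1 by lia.
exists (comm_coef (- j - 1) j (1 * ffall n) (h * ffall n)).
  by rewrite -[X in symbols X]rsE; apply: symbols_comm; rewrite ?rsE.
rewrite -size_poly_eq0 (size_comm_coef (p := n) (q := q)) //; first by lia.
- by lia.
- by rewrite mul1r size_ffall.
- nia.
Qed.

(** Brackets with one fixed nonzero f of degree -1 suffice. If f has degree q as
    a polynomial, then against g of degree m' in degree -(k+1) the criterion of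
    [size_comm_coef] reads m' <> q (k+1), so it holds for every large m'. *)
Lemma symbols_neg_degrees k : exists M, all_degrees_ge (symbols (Negz k)) M.
Proof.
have [f pf f0] := symbols_m1_neq0.
have [q nq sf] := symbols_degree (j := - 1) isT pf f0.
elim: k => [|k [M IH]].
  exists (q + n)%N => m qnm.
  have pg : symbols 0 ('X^(m.+1 - q - n) * ffall n) by apply: symbols_ge0.
  have sg : size ('X^(m.+1 - q - n) * ffall n : {poly F}) = (m.+1 - q).+1.
    rewrite size_mul ?ffall_neq0 ?expf_neq0 ?polyX_eq0 //.
    by rewrite size_polyXn size_ffall; lia.
  exists (comm_coef (- 1) 0 f ('X^(m.+1 - q - n) * ffall n)).
    by rewrite (_ : Negz 0 = - 1 + 0) //; apply: symbols_comm.
  by rewrite (size_comm_coef (p := q) (q := m.+1 - q)) //; lia.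
exists (M + q + q * k.+1).+1%N => m Mm.
have [m' mE Mm'] : exists2 m', m.+1 = (q + m')%N & (M + q * k.+1 < m')%N.
  by exists (m.+1 - q)%N; lia.
have [g pg sg] := IH m' ltac:(lia).
exists (comm_coef (- 1) (Negz k) f g).
  by rewrite (_ : Negz k.+1 = - 1 + Negz k); [apply: symbols_comm => //|]; lia.
by rewrite mE (size_comm_coef (p := q) (q := m')) //; lia.
Qed.

Lemma parabolic_nondegenerate : nondegenerate_parabolic (@Winf F n) p.
Proof.
move=> j j0; have [k ->] : exists k, - j = Negz k by exists `|j|.-1%N; lia.
have [M AM] := symbols_neg_degrees k.
(* The spanning vectors must themselves lie in the homogeneous component, hence
   the factor [w]_n. The remainder of a division has size at most M and is
   again divisible by [w]_n, so its quotient has size at most M too. *)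
pose e i : hatD F := tD (Negz k) ('X^i * ffall n).
exists [seq e i | i <- iota 0 M]; split=> [_ /mapP[i _ ->]|v].
  exact: Winf_tD.
move=> /(Winf_neq0E (isT : Negz k != 0))[f ->].
have [u Au su] := all_degrees_ge_reduce (f * ffall n) (subspace_symbols _) AM.
have [h hE] : exists h, f * ffall n - u = h * ffall n.
  have [g ->] := symbols_dvd (isT : Negz k != 0) Au.
  by exists (f - g); rewrite mulrBl.
have sh : (size h <= M)%N.
  have [->|h0] := eqVneq h 0; first by rewrite size_poly0.
  apply: leq_trans su; rewrite hE size_mul ?ffall_neq0 // size_ffall addnS.
  exact: leq_addr.
exists (fun i => h`_i); rewrite size_map size_iota.
suff -> : \sum_(i < M) h`_i *: [seq e i | i <- iota 0 M]`_i =
    tD (Negz k) (h * ffall n).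
  have {1}-> : f * ffall n = 1 *: (h * ffall n) + u by rewrite -hE scale1r subrK.
  by rewrite tD_linear scale1r addrC addKr.
have {2}-> : h = \sum_(i < M) h`_i *: 'X^i.
  rewrite -[LHS](coefK h) poly_def (big_ord_widen _ (fun i => h`_i *: 'X^i) sh).
  rewrite big_mkcond /=; apply: eq_bigr => i _; case: ltnP => // hi.
  by rewrite nth_default ?scale0r.
rewrite mulr_suml tD_sum; apply: eq_bigr => i _.
by rewrite (nth_map 0%N) ?size_iota // nth_iota // add0n -scalerAl tDZ.
Qed.

End Parabolic.

Lemma Winf_m1_nondegenerate (F : numFieldType) (n : nat) (d : hatD F) :
  (0 < n)%N -> Winf n (- 1) d -> d != 0 -> nondegenerate_elt (@Winf F n) d.
Proof.
move=> n0 Wd d0; apply: parabolic_nondegenerate => //.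
exact: parabolic_of_parabolic (Winf_graded _ n) Wd d0.
Qed.

Theorem proposition3p7 (R : realType) (n : nat) (n_ge1 : (1 <= n)%N) :
  let W := @Winf R[i] n in
  (forall d : hatD R[i], W (- 1) d -> d != 0 -> nondegenerate_elt W d) /\
  (forall p : int -> set (hatD R[i]), parabolic W p -> nondegenerate_parabolic W p) /\
  (forall a : {poly R[i]},
     let b := a * ffall n in
     let d := tD (- 1) b in
     [set lieb x d | x in W 1] =
     lspan [set tD 0 (shift (- 1) (ffall n) * g * b
                      - ffall n * shift 1 g * shift 1 b)
           | g in [set: {poly R[i]}]]).
Proof.
move=> W; split=> [d|]; first exact: Winf_m1_nondegenerate.
split=> [p|a b d]; first exact: parabolic_nondegenerate.
have b0 : b.[0] = 0 by rewrite hornerM horner_ffall0 ?mulr0.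
rewrite seteqP; split=> [_ [x Wx <-]|].
  have [f ->] := Winf_neq0E (isT : 1 != 0 :> int) Wx.
  have {1}-> : f = shift 1 (shift (- 1) f).
    by rewrite shift_shift subrr /shift addr0 comp_polyXr.
  by rewrite lieb_degree1 //; apply: sub_lspan; exists (shift (- 1) f).
apply: lspan_sub.
  exact/subspace_image_lieb/(gr_subspace (Winf_graded _ n)).
move=> _ [g _ <-]; exists (tD 1 (shift 1 g * ffall n)); first exact: Winf_tD.
exact: lieb_degree1.
Qed.
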